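(* If a system $(\mathrm D)$ of degree $n$ has a limit $\ell_\infty$-cycle, then it is projectively nonsingular and its degree $n$ is odd.
   Context: System $(\mathrm D)$ of degree $n$: $\frac{dx}{dt}=X(x,y)=\sum_{k=0}^n X_k(x,y)$, $\frac{dy}{dt}=Y(x,y)=\sum_{k=0}^n Y_k(x,y)$, where $X_k,Y_k$ are real homogeneous polynomials of degree $k$, $X_n$ and $Y_n$ are not both identically zero, and $X,Y$ are relatively prime (no common divisors other than real numbers). Put $W_n(x,y)=xY_n(x,y)-yX_n(x,y)$. The system is projectively singular if $W_n\equiv 0$ on $\mathbb{R}^2$, and projectively nonsingular otherwise. Reduced systems. The substitution $x=\frac1\theta$, $y=\frac{\xi}{\theta}$ turns $(\mathrm D)$ into $\frac{d\xi}{dt}=\theta^{-m}\Xi(\xi,\theta)$, $\frac{d\theta}{dt}=\theta^{-m}\Theta(\xi,\theta)$ with $m$ an integer and $\Xi,\Theta$ polynomials not both divisible by $\theta$; the first projectively reduced system is $\frac{d\xi}{d\tau}=\Xi$, $\frac{d\theta}{d\tau}=\Theta$. The substitution $x=\frac{\zeta}{\eta}$, $y=\frac1\eta$ turns $(\mathrm D)$ into $\frac{d\eta}{dt}=\eta^{-m}H(\eta,\zeta)$, $\frac{d\zeta}{dt}=\eta^{-m}Z(\eta,\zeta)$ with $H,Z$ polynomials not both divisible by $\eta$; the second projectively reduced system is $\frac{d\eta}{d\nu}=H$, $\frac{d\zeta}{d\nu}=Z$. The projective phase plane $\mathbb{RP}(x,y)$ is the plane $(x,y)$ completed by the line at infinity,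 covered by the charts $(x,y)$, $(\xi,\theta)=(\frac yx,\frac1x)$, $(\eta,\zeta)=(\frac1y,\frac xy)$; the line at infinity is $\theta=0$, respectively $\eta=0$. In these charts the trajectories are those of $(\mathrm D)$ and of the first and second projectively reduced systems. The projective sphere is the unit sphere, a two-sheeted cover of $\mathbb{RP}(x,y)$ in which $(x,y)$ corresponds to $\pm(x,y,-1)/\sqrt{1+x^2+y^2}$ and the line at infinity corresponds to the equator; trajectories on the sphere are lifts of trajectories on $\mathbb{RP}(x,y)$. The system has an $\ell_\infty$-cycle if the line at infinity is a (single, closed) trajectory of the system, so that it consists of regular points (points that are not equilibria). The $\ell_\infty$-cycle is a limit $\ell_\infty$-cycle if the equator of the projective sphere has a neighbourhood containing no closed trajectories of $(\mathrm D)$ other than the equator itself. *)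

(* Defs.v *)
From Stdlib Require Export Relation_Operators.
From HB Require Export structures.
From mathcomp Require Export all_boot all_order all_algebra.
(* The notations of mpoly clash with those of mathcomp-analysis. *)
From mathcomp Require Export -(notations) mpoly.
From mathcomp Require Export all_classical all_reals all_analysis.

Set Implicit Arguments.
Unset Strict Implicit.
Unset Printing Implicit Defensive.

Export Order.TTheory GRing.Theory Num.Theory.
Export numFieldNormedType.Exports.

Local Open Scope classical_set_scope.
Local Open Scope ring_scope.

Notation poly2 R := (mpoly 2 R).

Section Polynomials.
Variable R : realType.
Implicit Types (a b : R) (p X Y Xi Th H Z : poly2 R).

Definition var0 : poly2 R := mpolyX R (mnm1 ord0).
Definition var1 : poly2 R := mpolyX R (mnm1 ord_max).

Definition ev2 p a b : R := meval (tnth [tuple a; b]) p.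

Definition divides2 p q : Prop := exists r : poly2 R, q = p * r.

(* Relatively prime in the sense "no common divisors other than real numbers";
   this excludes X = Y = 0. *)
Definition relatively_prime X Y : Prop :=
  forall p, divides2 p X -> divides2 p Y -> exists c : R, p = mpolyC 2 c.

(* X k and Y k are the homogeneous components X_k and Y_k, 0 <= k <= n. *)
Definition systemD n (X Y : 'I_n.+1 -> poly2 R) : Prop :=
  [/\ forall k : 'I_n.+1, X k \is ishomog1 k mdeg,
      forall k : 'I_n.+1, Y k \is ishomog1 k mdeg,
      ~ (X ord_max = 0 /\ Y ord_max = 0) &
      relatively_prime (\sum_k X k) (\sum_k Y k)].

Definition Wn n (X Y : 'I_n.+1 -> poly2 R) : poly2 R :=
  var0 * Y ord_max - var1 * X ord_max.

Definition projectively_singular n (X Y : 'I_n.+1 -> poly2 R) : Prop :=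
  forall x y : R, ev2 (Wn X Y) x y = 0.

Definition projectively_nonsingular n (X Y : 'I_n.+1 -> poly2 R) : Prop :=
  ~ projectively_singular X Y.

(* With xi = y/x and theta = 1/x, the chain rule gives
     xi' = theta (Y - xi X)   and   theta' = - theta^2 X
   at (x, y) = (1/theta, xi/theta). The polynomials Xi and Th are in the
   variables (xi, theta), in this order. *)
Definition first_reduced X Y (m : int) Xi Th : Prop :=
  (forall xi theta : R, theta != 0 ->
     theta * (ev2 Y theta^-1 (xi / theta) - xi * ev2 X theta^-1 (xi / theta))
       = theta ^ (- m) * ev2 Xi xi theta /\
     - theta ^+ 2 * ev2 X theta^-1 (xi / theta)
       = theta ^ (- m) * ev2 Th xi theta) /\
  ~ (divides2 var1 Xi /\ divides2 var1 Th).

(* With eta = 1/y and zeta = x/y, the chain rule gives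
     eta' = - eta^2 Y   and   zeta' = eta (X - zeta Y)
   at (x, y) = (zeta/eta, 1/eta). The polynomials H and Z are in the
   variables (eta, zeta), in this order. *)
Definition second_reduced X Y (m : int) H Z : Prop :=
  (forall eta zeta : R, eta != 0 ->
     - eta ^+ 2 * ev2 Y (zeta / eta) eta^-1
       = eta ^ (- m) * ev2 H eta zeta /\
     eta * (ev2 X (zeta / eta) eta^-1 - zeta * ev2 Y (zeta / eta) eta^-1)
       = eta ^ (- m) * ev2 Z eta zeta) /\
  ~ (divides2 var0 H /\ divides2 var0 Z).

End Polynomials.

(* The charts (x, y), (xi, theta) and (eta, zeta). *)
Variant chart := ChartXY | ChartXiTheta | ChartEtaZeta.

(* The right-hand sides of the autonomous systems in the three charts. *)
Definition chart_systems (R : realType) := chart -> poly2 R * poly2 R.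

Definition projective_systems (R : realType) (X Y Xi Th H Z : poly2 R)
    : chart_systems R := fun k =>
  match k with
  | ChartXY => (X, Y)
  | ChartXiTheta => (Xi, Th)
  | ChartEtaZeta => (H, Z)
  end.

Section ProjectivePhasePlane.
Variable R : realType.
Implicit Types (S : chart_systems R) (k : chart).

Definition R3 : Type := (R * R * R)%type.

(* A point of the projective plane is represented by the set of its homogeneous
   coordinate vectors. *)
Definition proj (v : R3) : set R3 := [set c *: v | c in [set c : R | c != 0]].

Definition RP : set (set R3) := [set proj v | v in [set v : R3 | v != 0]].

(* Homogeneous coordinates are normalized so that (x, y) is the class of
   (x, y, -1); the other two charts are then given by
   (1/theta, xi/theta, -1) ~ (1, xi, -theta) and
   (zeta/eta, 1/eta, -1) ~ (zeta, 1, -eta), which also cover infinity. *)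
Definition chart_vec k (a b : R) : R3 :=
  match k with
  | ChartXY => (a, b, -1)
  | ChartXiTheta => (1, a, - b)
  | ChartEtaZeta => (b, 1, - a)
  end.

Definition chart_pt k (a b : R) : set R3 := proj (chart_vec k a b).

Definition line_at_infinity : set (set R3) :=
  [set chart_pt ChartXiTheta xi 0 | xi in [set: R]] `|`
  [set chart_pt ChartEtaZeta 0 zeta | zeta in [set: R]].

Definition solution S k (a b : R) (z1 z2 : R -> R) : Prop :=
  forall t : R, a < t < b ->
    is_derive t 1 z1 (ev2 (S k).1 (z1 t) (z2 t)) /\
    is_derive t 1 z2 (ev2 (S k).2 (z1 t) (z2 t)).

(* p and q lie on a common trajectory of the system of one of the charts. *)
Definition RP_arc S (p q : set R3) : Prop :=
  exists k (a b : R) (z1 z2 : R -> R) (s t : R),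
    [/\ solution S k a b z1 z2, a < s < b, a < t < b,
        p = chart_pt k (z1 s) (z2 s) & q = chart_pt k (z1 t) (z2 t)].

(* The times of the charts differ by nonvanishing factors where the charts
   overlap, so that trajectories are obtained by gluing those of the charts
   as point sets; RP_arc is symmetric, hence they partition RP. *)
Definition RP_trajectory S (T : set (set R3)) : Prop :=
  exists2 p, RP p & T = [set q | clos_refl_trans (set R3) (RP_arc S) p q].

Definition equilibrium S (p : set R3) : Prop :=
  exists k (a b : R),
    [/\ p = chart_pt k a b, ev2 (S k).1 a b = 0 & ev2 (S k).2 a b = 0].

(* Simple closed curves in RP; every closed path in RP lifts to a path f of
   vectors, which need not be periodic. *)
Definition RP_closed_curve (T : set (set R3)) : Prop :=
  exists f : R -> R3,
    [/\ continuous f, forall t, f t != 0,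
        forall s t, proj (f s) = proj (f t) <-> exists j : int, s - t = j%:~R &
        T = range (proj \o f)].

Definition has_linfty_cycle S : Prop :=
  [/\ RP_trajectory S line_at_infinity, RP_closed_curve line_at_infinity &
      forall p, line_at_infinity p -> ~ equilibrium S p].

Definition sphere : set R3 :=
  [set u | u.1.1 ^+ 2 + u.1.2 ^+ 2 + u.2 ^+ 2 = 1].

Definition equator : set R3 := [set u | sphere u /\ u.2 = 0].

(* u and v lie on a common lift, under proj : sphere -> RP, of a trajectory of
   the system of one of the charts. *)
Definition sphere_arc S (u v : R3) : Prop :=
  exists k (a b : R) (z1 z2 : R -> R) (f : R -> R3) (s t : R),
    [/\ solution S k a b z1 z2,
        forall r, a < r < b ->
          [/\ {for r, continuous f}, sphere (f r) &
              proj (f r) = chart_pt k (z1 r) (z2 r)],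
        a < s < b /\ a < t < b, u = f s & v = f t].

Definition sphere_trajectory S (T : set R3) : Prop :=
  exists2 u, sphere u & T = [set v | clos_refl_trans R3 (sphere_arc S) u v].

Definition closed_curve (T : set R3) : Prop :=
  exists f : R -> R3,
    [/\ continuous f,
        forall s t, f s = f t <-> exists j : int, s - t = j%:~R &
        T = range f].

Definition sphere_closed_trajectory S (T : set R3) : Prop :=
  sphere_trajectory S T /\ closed_curve T.

Definition has_limit_linfty_cycle S : Prop :=
  has_linfty_cycle S /\
  exists U : set R3,
    [/\ open U, equator `<=` U &
        forall T, sphere_closed_trajectory S T -> T `<=` U -> T = equator].

End ProjectivePhasePlane.

(* Main.v *)
From Stdlib Require Import Operators_Properties.
From mathcomp Require Import zify ring lra.
Require Import Defs.
Local Open Scope classical_set_scope.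
Local Open Scope ring_scope.

(** By homogeneity, in the chart (xi, theta) the system (D) reads
      xi'    =   sum_k theta^(1-k) W_k(1, xi),
      theta' = - sum_k theta^(2-k) X_k(1, xi),
    where W_k = x Y_k - y X_k. Clearing theta therefore leaves on theta = 0
    either (W_n(1, xi), 0), when W_n is not identically zero, or
    (W_(n-1)(1, xi), -X_n(1, xi)), when it is; the chart (eta, zeta) behaves
    in the same way, with W_n(zeta, 1) and Y_n(zeta, 1). The dichotomy in terms
    of the exponent m is [reduced_at_infinity].

    If W_n is identically zero, the vector field crosses the line at infinity
    wherever X_n(1, xi) is nonzero. But when the line is a single trajectory,
    each of its points lies on a solution that stays on the line, hence the
    field is tangent to it ([line_tangent]: a trajectory with more than one
    point consists of arcs, which provide the solutions). So X_n(1, xi) = 0 for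
    all nonzero xi, whence X_n = 0, and then Y_n = 0 from W_n = 0: the degree
    would be less than n.

    If W_n is not identically zero, its zeros on the line at infinity are
    equilibria. For n even, W_n is homogeneous of odd degree n + 1, so it
    changes sign between opposite vectors and has a nontrivial real zero
    ([odd_homog_zero]). An l_oo-cycle has no equilibria, so n is odd. *)

(** * Homogeneous polynomials in two variables *)

Lemma big_ord2 (T : Type) (idx : T) (op : Monoid.law idx) (F : 'I_2 -> T) :
  \big[op/idx]_(i < 2) F i = op (F ord0) (F ord_max).
Proof. by rewrite big_ord_recr big_ord1 /=; congr (op (F _) _); apply: val_inj. Qed.

Section Algebra.
Set Implicit Arguments.
Unset Strict Implicit.
Variable R : realType.
Implicit Types (p q : poly2 R) (P Q a b : {poly R}).

(** A substitute for passing to the limit t -> 0 in identities that hold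
    in a chart only away from the line at infinity. *)
Lemma poly_eq_punctured P Q : (forall t, t != 0 -> P.[t] = Q.[t]) -> P = Q.
Proof.
move=> PQ; apply/eqP; rewrite -subr_eq0; apply/eqP.
pose s := [seq i.+1%:R : R | i <- iota 0 (size (P - Q))].
apply: (@roots_geq_poly_eq0 _ _ s); last by rewrite size_map size_iota.
- apply/allP => _ /mapP[i _ ->].
  by rewrite rootE hornerD hornerN PQ ?subrr ?pnatr_eq0.
- by rewrite map_inj_uniq ?iota_uniq// => i j /eqP; rewrite eqr_nat => /eqP[].
Qed.

Lemma ev2E p (x y : R) :
  ev2 p x y = \sum_(m <- msupp p) mcoeff m p * (x ^+ m ord0 * y ^+ m ord_max).
Proof.
by rewrite /ev2 mevalE; apply: eq_bigr => m _; rewrite big_ord2.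
Qed.

(** Restricting p to the parametrized curve (a(t), b(t)) turns questions about
    values of p into questions about a univariate polynomial in t. *)
Definition subst2 p a b : {poly R} := mmap polyC (tnth [tuple a; b]) p.

Lemma subst2E p a b : subst2 p a b =
  \sum_(m <- msupp p) (mcoeff m p)%:P * (a ^+ m ord0 * b ^+ m ord_max).
Proof.
by apply: eq_bigr => m _; rewrite /mmap1 big_ord2.
Qed.

Lemma horner_subst2 p a b t : (subst2 p a b).[t] = ev2 p a.[t] b.[t].
Proof.
rewrite subst2E ev2E horner_sum; apply: eq_bigr => m _.
by rewrite !(hornerM, hornerC, horner_exp).
Qed.

Lemma ev2_sum (I : finType) (F : I -> poly2 R) x y :
  ev2 (\sum_i F i) x y = \sum_i ev2 (F i) x y.
Proof. by rewrite /ev2 raddf_sum. Qed.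

Lemma msupp_homog d p m : p \is ishomog1 d mdeg -> m \in msupp p ->
  (m ord0 + m ord_max)%N = d.
Proof. by move=> /dhomog_mf hp /hp <-; apply/esym; rewrite -big_ord2; exact: mdegE. Qed.

Lemma ev2_homog d p (c x y : R) : p \is ishomog1 d mdeg ->
  ev2 p (c * x) (c * y) = c ^+ d * ev2 p x y.
Proof.
move=> hp; rewrite !ev2E mulr_sumr; apply: eq_big_seq => m mp.
by rewrite -(msupp_homog hp mp) exprD !exprMn; ring.
Qed.

(** Dehomogenization loses nothing: among monomials of degree d, the exponent of
    the second variable determines the monomial, so the coefficients of p(1, t)
    are those of p. *)
Lemma homog_eq0 d p : p \is ishomog1 d mdeg ->
  (forall t, t != 0 -> ev2 p 1 t = 0) -> p = 0.
Proof.
move=> hp p0.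
have P0 : subst2 p 1 'X = 0.
  apply: poly_eq_punctured => t t0.
  by rewrite horner_subst2 hornerX !hornerC p0.
apply/mpolyP => m; rewrite mcoeff0.
have [mp|/memN_msupp_eq0//] := boolP (m \in msupp p).
have := congr1 (coefp (m ord_max)) P0.
rewrite subst2E raddf_sum /= coef0 (bigD1_seq m)//= ?msupp_uniq//.
rewrite big1_seq ?addr0 => [|k /andP[km kp]].
  by rewrite expr1n mul1r coefCM coefXn eqxx mulr1.
rewrite expr1n mul1r coefCM coefXn; case: eqP => [e|_]; last by rewrite mulr0.
case/eqP: km; apply/mnmP => i.
have := msupp_homog hp mp; rewrite -(msupp_homog hp kp) e => /addIn e0.
have [->|->] // : i = ord0 \/ i = ord_max.
by case: i => [[|[|//]] i2]; [left|right]; apply: val_inj.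
Qed.

Lemma ev2_W n (X Y : 'I_n.+1 -> poly2 R) x y :
  ev2 (Wn X Y) x y = x * ev2 (Y ord_max) x y - y * ev2 (X ord_max) x y.
Proof. by rewrite /ev2 /Wn mevalB !mevalM !mevalXU. Qed.

Lemma W_homog n (X Y : 'I_n.+1 -> poly2 R) :
  X ord_max \is ishomog1 n mdeg -> Y ord_max \is ishomog1 n mdeg ->
  Wn X Y \is ishomog1 n.+1 mdeg.
Proof.
move=> hX hY.
have hvar i p : p \is ishomog1 n mdeg ->
    (mpolyX R (mnm1 i) * p) \is ishomog1 n.+1 mdeg.
  by move=> hp; apply: (@dhomogM _ _ mdeg 1) hp; rewrite dhomogX /= mdeg1.
exact: rpredB (hvar _ _ hY) (hvar _ _ hX).
Qed.

(** The curve (1 - 2t, t(1 - t)), 0 <= t <= 1, joins (1, 0) to (-1, 0) and avoids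
    the origin; p takes opposite values at its ends. *)
Lemma odd_homog_zero n p : p \is ishomog1 n mdeg -> odd n ->
  exists x y : R, (x != 0) || (y != 0) /\ ev2 p x y = 0.
Proof.
move=> hp on.
pose a : {poly R} := 1 - 2%:P * 'X; pose b : {poly R} := 'X * (1 - 'X).
have zero t : root (subst2 p a b) t ->
    exists x y : R, (x != 0) || (y != 0) /\ ev2 p x y = 0.
  rewrite rootE horner_subst2 => /eqP h; exists a.[t], b.[t]; split=> //.
  rewrite -negb_and; apply/negP; rewrite !hornerE => /andP[/eqP h1 /eqP h2].
  nra.
have e1 : (subst2 p a b).[1] = - (subst2 p a b).[0].
  rewrite !horner_subst2.
  have -> : a.[1] = -1 * a.[0] by rewrite !hornerE; ring.
  have -> : b.[1] = -1 * b.[0] by rewrite !hornerE /=; ring.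
  by rewrite (ev2_homog _ _ _ hp) -signr_odd on expr1 mulN1r.
have [l0|g0] := leP (subst2 p a b).[0] 0.
  have [|t _ /zero//] := @poly_ivt _ (subst2 p a b) 0 1 ler01.
  by rewrite l0 e1 oppr_ge0.
have [|t _ ht] := @poly_ivt _ (- subst2 p a b) 0 1 ler01.
  by rewrite !hornerN e1 opprK oppr_le0 ltW.
by apply: (zero t); rewrite -rootN.
Qed.

(** Multiplied by t^n, the sum becomes the polynomial A with A(0) = c_n, and the
    hypothesis becomes t^(m+d) A(t) = t^n P(t). Comparing the two exponents at
    t = 0 gives the three cases. *)
Lemma leading_at_infinity n (c : 'I_n.+1 -> R) (d : nat) (m : int) P :
  (forall t, t != 0 -> t ^+ d * \sum_k c k * t ^- k = t ^ (- m) * P.[t]) ->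
  [/\ (n%:Z < m + d%:Z -> P.[0] = 0),
      (m + d%:Z = n%:Z -> P.[0] = c ord_max) &
      (m + d%:Z < n%:Z -> c ord_max = 0)].
Proof.
move=> h; pose A : {poly R} := \sum_k c k *: 'X^(n - k).
have A0 : A.[0] = c ord_max.
  rewrite /A horner_sum (bigD1 ord_max) //= big1 ?addr0 => [|k kn].
    by rewrite !hornerE subnn expr0 mulr1.
  rewrite !hornerE expr0n subn_eq0 leqNgt.
  by rewrite ltn_neqAle -ltnS ltn_ord andbT kn mulr0.
have hA t : t != 0 -> t ^ (m + d%:Z) * A.[t] = t ^ n%:Z * P.[t].
  move=> t0; have -> : A.[t] = t ^+ n * \sum_k c k * t ^- k.
    rewrite /A horner_sum mulr_sumr; apply: eq_bigr => k _.
    rewrite hornerZ hornerXn mulrCA; congr (_ * _).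
    by rewrite exprB ?unitfE ?leq_ord.
  rewrite expfzDr// -!exprnP -mulrA [t ^+ d * _]mulrCA h// mulrCA.
  by rewrite [t ^ m * _]mulrA -expfzDr// subrr expr0z mul1r.
have pow (i j : int) (P1 P2 : {poly R}) :
    (forall t, t != 0 -> t ^ i * P1.[t] = t ^ j * P2.[t]) -> i <= j ->
    P1 = 'X^`|j - i| * P2.
  move=> h12 ij; apply: poly_eq_punctured => t t0; rewrite hornerM hornerXn.
  rewrite exprnP gez0_abs ?subr_ge0// expfzDr// mulrAC -h12// mulrAC.
  by rewrite -expfzDr// subrr expr0z mul1r.
split=> [lt|e|lt].
- rewrite (pow n%:Z (m + d%:Z) P A) ?ltW// => [|t t0]; last by rewrite hA.
  rewrite hornerM hornerXn expr0n absz_eq0 subr_eq0 gt_eqF// mul0r//.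
- by rewrite (pow n%:Z (m + d%:Z) P A) ?e ?lexx// ?subrr ?expr0 ?mul1r// => t t0; rewrite -e hA// e.
- rewrite -A0 (pow (m + d%:Z) n%:Z A P) ?ltW//.
  by rewrite hornerM hornerXn expr0n absz_eq0 subr_eq0 gt_eqF// mul0r.
Qed.

End Algebra.

(** * The reduced systems on the line at infinity *)

Section Infinity.
Set Implicit Arguments.
Unset Strict Implicit.
Variable R : realType.
Implicit Types (S : chart_systems R) (p q : set (R3 R)).

(** Along a chart line transverse to infinity, P and Q are the components of the
    reduced field tangent and normal to infinity, w_k stands for W_k and x_k for
    -X_k or -Y_k. The reduced field vanishes at a zero of W_n unless m + 1 < n;
    this inequality itself forces W_n = 0, and then tangency of the field to the
    line, Q(0) = 0, forces x_n = 0. As m does not depend on the point of the line,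
    the alternative is global: it separates nonsingular from singular systems. *)
Lemma reduced_at_infinity n (w x : 'I_n.+1 -> R) (m : int) (P Q : {poly R}) :
  (forall t, t != 0 -> t * \sum_k w k * t ^- k = t ^ (- m) * P.[t]) ->
  (forall t, t != 0 -> t ^+ 2 * \sum_k x k * t ^- k = t ^ (- m) * Q.[t]) ->
  (w ord_max = 0 -> P.[0] = 0 /\ Q.[0] = 0 \/ m + 1 < n%:Z) /\
  (m + 1 < n%:Z -> w ord_max = 0 /\ (Q.[0] = 0 -> x ord_max = 0)).
Proof.
move=> hP hQ.
have [P1 P2 P3] := @leading_at_infinity _ _ w 1 m P hP.
have [Q1 Q2 Q3] := leading_at_infinity hQ.
split=> [w0|lt].
  have [lt|ge] := ltP (m + 1) n%:Z; [by right|left].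
  split; last by apply: Q1; lia.
  by have [|gt|e] := ltgtP n%:Z (m + 1); [exact: P1|lia|rewrite P2].
split=> [|Q0]; first exact: P3.
by have [|gt|e] := ltgtP (m + 2) n%:Z; [exact: Q3|lia|rewrite -Q2].
Qed.

Lemma first_at_infinity n (X Y : 'I_n.+1 -> poly2 R) m Xi Th :
  (forall k : 'I_n.+1, X k \is ishomog1 k mdeg) ->
  (forall k : 'I_n.+1, Y k \is ishomog1 k mdeg) ->
  first_reduced (\sum_k X k) (\sum_k Y k) m Xi Th ->
  forall xi,
  (ev2 (Wn X Y) 1 xi = 0 ->
     ev2 Xi xi 0 = 0 /\ ev2 Th xi 0 = 0 \/ m + 1 < n%:Z) /\
  (m + 1 < n%:Z -> ev2 (Wn X Y) 1 xi = 0 /\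
     (ev2 Th xi 0 = 0 -> ev2 (X ord_max) 1 xi = 0)).
Proof.
move=> hX hY [h _] xi.
have sumE (F : 'I_n.+1 -> poly2 R) t :
    (forall k : 'I_n.+1, F k \is ishomog1 k mdeg) ->
    ev2 (\sum_k F k) t^-1 (xi / t) = \sum_k ev2 (F k) 1 xi * t ^- k.
  move=> hF; rewrite ev2_sum; apply: eq_bigr => k _.
  rewrite -{1}[t^-1]mulr1 [xi / t]mulrC (ev2_homog _ _ _ (hF k)).
  by rewrite exprVn mulrC.
have := @reduced_at_infinity n
  (fun k => ev2 (Y k) 1 xi - xi * ev2 (X k) 1 xi) (fun k => - ev2 (X k) 1 xi)
  m (subst2 Xi xi%:P 'X) (subst2 Th xi%:P 'X).
rewrite !horner_subst2 !hornerC !hornerX ev2_W mul1r.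
case=> [t t0|t t0|H1 H2].
- rewrite horner_subst2 hornerC hornerX; case: (h xi t t0) => <- _.
  rewrite !sumE// mulr_sumr -sumrB; congr (_ * _).
  by apply: eq_bigr => k _; rewrite mulrBl mulrA.
- rewrite horner_subst2 hornerC hornerX; case: (h xi t t0) => _ <-.
  rewrite sumE// mulNr -mulrN -sumrN; congr (_ * _).
  by apply: eq_bigr => k _; rewrite mulNr.
- split=> // /H2[-> Q0]; split=> // /Q0 /eqP.
  by rewrite oppr_eq0 => /eqP.
Qed.

Lemma second_at_infinity n (X Y : 'I_n.+1 -> poly2 R) m H Z :
  (forall k : 'I_n.+1, X k \is ishomog1 k mdeg) ->
  (forall k : 'I_n.+1, Y k \is ishomog1 k mdeg) ->
  second_reduced (\sum_k X k) (\sum_k Y k) m H Z ->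
  forall zeta,
  (ev2 (Wn X Y) zeta 1 = 0 ->
     ev2 H 0 zeta = 0 /\ ev2 Z 0 zeta = 0 \/ m + 1 < n%:Z) /\
  (m + 1 < n%:Z -> ev2 (Wn X Y) zeta 1 = 0 /\
     (ev2 H 0 zeta = 0 -> ev2 (Y ord_max) zeta 1 = 0)).
Proof.
move=> hX hY [h _] zeta.
have sumE (F : 'I_n.+1 -> poly2 R) t :
    (forall k : 'I_n.+1, F k \is ishomog1 k mdeg) ->
    ev2 (\sum_k F k) (zeta / t) t^-1 = \sum_k ev2 (F k) zeta 1 * t ^- k.
  move=> hF; rewrite ev2_sum; apply: eq_bigr => k _.
  rewrite -{2}[t^-1]mulr1 [zeta / t]mulrC (ev2_homog _ _ _ (hF k)).
  by rewrite exprVn mulrC.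
have := @reduced_at_infinity n
  (fun k => ev2 (X k) zeta 1 - zeta * ev2 (Y k) zeta 1)
  (fun k => - ev2 (Y k) zeta 1)
  m (subst2 Z 'X zeta%:P) (subst2 H 'X zeta%:P).
rewrite !horner_subst2 !hornerC !hornerX ev2_W mul1r.
case=> [t t0|t t0|H1 H2].
- rewrite horner_subst2 hornerC hornerX; case: (h t zeta t0) => _ <-.
  rewrite !sumE// mulr_sumr -sumrB; congr (_ * _).
  by apply: eq_bigr => k _; rewrite mulrBl mulrA.
- rewrite horner_subst2 hornerC hornerX; case: (h t zeta t0) => <- _.
  rewrite sumE// mulNr -mulrN -sumrN; congr (_ * _).
  by apply: eq_bigr => k _; rewrite mulNr.
- split=> [W0|/H2[W0 Q0]].
    by case: H1 => [|[]|]; [lra|left|right].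
  split=> [|/Q0 /eqP]; first lra.
  by rewrite oppr_eq0 => /eqP.
Qed.

(** * Trajectories contained in the line at infinity *)

Lemma proj_eq (v w : R3 R) : proj v = proj w -> exists2 c, c != 0 & w = c *: v.
Proof.
move=> vw; have : proj w w by exists 1; rewrite /= ?oner_eq0// scale1r.
by rewrite -vw => -[c c0 <-]; exists c.
Qed.

Lemma line_at_infinity_proj (v : R3 R) : line_at_infinity (proj v) -> v.2 = 0.
Proof.
by case=> -[a _] /proj_eq[c _ ->] /=; rewrite oppr0 scaler0.
Qed.

Lemma chart1_inj (xi xi' : R) :
  chart_pt ChartXiTheta xi 0 = chart_pt ChartXiTheta xi' 0 -> xi = xi'.
Proof.
move=> /proj_eq[c _ [c1 -> _]]; move: c1; rewrite /GRing.scale /=.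
by rewrite mulr1 => <-; rewrite mul1r.
Qed.

Lemma chart12_eq (xi zeta : R) :
  chart_pt ChartXiTheta xi 0 = chart_pt ChartEtaZeta 0 zeta -> 1 = zeta * xi.
Proof.
by move=> /proj_eq[c _ [-> e _]]; rewrite /GRing.scale /= mulr1.
Qed.

Lemma derive_zero (a b s d : R) (z : R -> R) :
  (forall t, a < t < b -> z t = 0) -> a < s < b -> is_derive s 1 z d -> d = 0.
Proof.
move=> z0 sab dz.
have : is_derive s 1 (cst 0 : R -> R) d.
  apply: near_eq_is_derive dz; near=> t; apply: z0.
  by have : t \in `]a, b[ by near: t; exact: near_in_itvoo.
by move=> /@derive_val; rewrite derive_cst.
Unshelve. all: by end_near. Qed.

Lemma RP_arc_sym S p q : RP_arc S p q -> RP_arc S q p.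
Proof.
move=> [k [a [b [z1 [z2 [s [t [hz hs ht -> ->]]]]]]]].
by exists k, a, b, z1, z2, t, s.
Qed.

Lemma reach_sym S p q : clos_refl_trans _ (RP_arc S) p q ->
  clos_refl_trans _ (RP_arc S) q p.
Proof.
elim=> [x y /RP_arc_sym|x|x y z _ yx _ zy]; [exact: rt_step|exact: rt_refl|].
exact: rt_trans zy yx.
Qed.

Lemma line_reach S p q : RP_trajectory S (@line_at_infinity R) ->
  line_at_infinity p -> (line_at_infinity q <-> clos_refl_trans _ (RP_arc S) p q).
Proof.
move=> [p0 _ ->] /= p0p; split=> [p0q|]; last exact: rt_trans.
exact: rt_trans (reach_sym p0p) p0q.
Qed.

(** The line has more than one point, so a chain of arcs joining p to another
    point has a first step. *)
Lemma line_moves S p : RP_trajectory S (@line_at_infinity R) ->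
  line_at_infinity p -> exists q, RP_arc S p q.
Proof.
move=> hS lp.
have [q lq pq] : exists2 q, line_at_infinity q & p <> q.
  have [->|p0] := pselect (p = chart_pt ChartXiTheta 0 0).
    exists (chart_pt ChartXiTheta 1 0); first by left; exists 1.
    by move=> /chart1_inj /eqP; rewrite eq_sym oner_eq0.
  by exists (chart_pt ChartXiTheta 0 0) => //; left; exists 0.
have /clos_rt_rt1n_iff h := (line_reach q hS lp).1 lq.
by case: h pq => // y z py _ _; exists y.
Qed.

(** The arc through a point of the line stays on the line, since the line is the
    whole trajectory; in its chart the coordinate normal to infinity vanishes
    along the solution, hence so does its derivative. The two cases are the two
    charts at infinity, the slope xi being 1/zeta in the second. *)
Lemma line_tangent S (xi : R) : RP_trajectory S (@line_at_infinity R) ->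
  ev2 (S ChartXiTheta).2 xi 0 = 0 \/
  exists2 zeta, zeta * xi = 1 & ev2 (S ChartEtaZeta).1 0 zeta = 0.
Proof.
move=> hS; have lp : line_at_infinity (chart_pt ChartXiTheta xi 0).
  by left; exists xi.
have [q [k [a [b [z1 [z2 [s [t [hz hs _ pE _]]]]]]]]] := line_moves hS lp.
have stay r : a < r < b -> (chart_vec k (z1 r) (z2 r)).2 = 0.
  move=> hr; apply: line_at_infinity_proj; apply/(line_reach _ hS lp).
  by apply: rt_step; rewrite pE; exists k, a, b, z1, z2, s, r.
have [d1 d2] := hz s hs.
case: k hz pE stay d1 d2 => hz pE stay d1 d2 /=.
- by have /eqP := stay s hs; rewrite /= oppr_eq0 oner_eq0.
- have z0 r : a < r < b -> z2 r = 0 by move=> /stay /eqP; rewrite oppr_eq0 => /eqP.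
  left; move: pE; rewrite (z0 s hs) => /chart1_inj ->.
  by have := derive_zero z0 hs d2; rewrite (z0 s hs).
- have z0 r : a < r < b -> z1 r = 0 by move=> /stay /eqP; rewrite oppr_eq0 => /eqP.
  right; exists (z2 s).
    by move: pE; rewrite (z0 s hs) => /chart12_eq.
  by have := derive_zero z0 hs d1; rewrite (z0 s hs).
Qed.

End Infinity.

(** * Nonsingularity and parity of the degree *)

Theorem mainTheorem10 (R : realType) (n : nat) (X Y : 'I_n.+1 -> poly2 R)
    (m1 m2 : int) (Xi Th H Z : poly2 R)
    (hD : systemD X Y)
    (hred1 : first_reduced (\sum_k X k) (\sum_k Y k) m1 Xi Th)
    (hred2 : second_reduced (\sum_k X k) (\sum_k Y k) m2 H Z)
    (hcycle : has_limit_linfty_cycle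
       (projective_systems (\sum_k X k) (\sum_k Y k) Xi Th H Z)) :
  projectively_nonsingular X Y /\ odd n.
Proof.
case: hD => hX hY hXY _; case: hcycle => -[traj _ reg] _.
set S := projective_systems _ _ _ _ _ _ in traj reg.
have hW := W_homog (hX ord_max) (hY ord_max).
have reg1 xi : ev2 Xi xi 0 = 0 /\ ev2 Th xi 0 = 0 -> False.
  move=> [e1 e2]; apply: (reg (chart_pt ChartXiTheta xi 0)).
    by left; exists xi.
  by exists ChartXiTheta, xi, 0.
have reg2 zeta : ev2 H 0 zeta = 0 /\ ev2 Z 0 zeta = 0 -> False.
  move=> [e1 e2]; apply: (reg (chart_pt ChartEtaZeta 0 zeta)).
    by right; exists zeta.
  by exists ChartEtaZeta, 0, zeta.
have inf1 := first_at_infinity hX hY hred1.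
have inf2 := second_at_infinity hX hY hred2.
have nonsing : projectively_nonsingular X Y.
  move=> sing; apply: hXY.
  have Xn0 : X ord_max = 0.
    apply: (homog_eq0 (hX ord_max)) => xi xi0.
    (* Both charts at infinity are needed: the arc through the point of slope xi
       may be one of the second reduced system. *)
    have [T0|[zeta zx H0]] := line_tangent xi traj.
      have [/(_ (sing _ _))[/reg1//|lt] h] := inf1 xi.
      by case: (h lt) => _ ->.
    have [/(_ (sing _ _))[/reg2//|lt] h] := inf2 zeta.
    have [_ /(_ H0) Y0] := h lt.
    have := ev2_homog zeta 1 xi (hX ord_max).
    have := sing zeta 1; rewrite ev2_W Y0 mulr0 mul1r mulr1 zx sub0r.
    move=> /eqP; rewrite oppr_eq0 => /eqP -> /esym /eqP.
    rewrite mulf_eq0 expf_eq0 => /orP[/andP[_ /eqP z0]|/eqP//].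
    by move: zx; rewrite z0 mul0r => /esym/eqP; rewrite oner_eq0.
  split=> //; apply: (homog_eq0 (hY ord_max)) => xi _.
  by have := sing 1 xi; rewrite ev2_W Xn0 /ev2 meval0 mulr0 subr0 mul1r.
split=> //; apply/negPn/negP => en.
(* A nontrivial zero (x, y) of W_n is an equilibrium at infinity, seen in the
   second chart when x = 0 and in the first one otherwise. *)
have [x [y [xy Wxy]]] := odd_homog_zero hW en.
have W0 : Wn X Y = 0 -> False.
  by move=> e; apply: nonsing => u v; rewrite e /ev2 meval0.
have [x0|x0] := eqVneq x 0.
  have y0 : y != 0 by move: xy; rewrite x0 eqxx.
  have W01 : ev2 (Wn X Y) 0 1 = 0.
    have := ev2_homog y^-1 x y hW; rewrite Wxy x0 !mulr0 mulVf//.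
  have [/(_ W01)[/reg2//|lt] _] := inf2 0.
  apply: W0; apply: (homog_eq0 hW) => t t0.
  have := ev2_homog t t^-1 1 hW; rewrite mulfV// mulr1 => ->.
  by have [_ /(_ lt)[-> _]] := inf2 t^-1; rewrite mulr0.
have W1 : ev2 (Wn X Y) 1 (y / x) = 0.
  by have := ev2_homog x^-1 x y hW; rewrite Wxy mulr0 mulVf// mulrC.
have [/(_ W1)[/reg1//|lt] _] := inf1 (y / x).
apply: W0; apply: (homog_eq0 hW) => t _.
by have [_ /(_ lt)[-> _]] := inf1 t.
Qed.
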